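(* Let $(\Omega,\mathcal{F}_2,\mathbb{P})$ be a probability space, let $\mathcal{F}_1\subset\mathcal{F}_2$ be a sub sigma algebra, and suppose that the conditional expectation with respect to $\mathcal{F}_1$ is given by a kernel $K\colon\Omega\times\mathcal{F}_2\to[0,1]$. (a) If $\mathcal{F}_2$ is atomless conditionally to $\mathcal{F}_1$, then for almost every $\omega\in\Omega$ the probability measure $K(\omega,\cdot)$ is atomless on $\mathcal{F}_2$. (b) If the sigma algebra $\mathcal{F}_2$ is generated by a countable family of sets, the converse holds: if for almost every $\omega\in\Omega$ the probability measure $K(\omega,\cdot)$ is atomless on $\mathcal{F}_2$, then $\mathcal{F}_2$ is atomless conditionally to $\mathcal{F}_1$.
   Context: Definition. $\mathcal{F}_2$ is atomless conditionally to $\mathcal{F}_1$ if for every $A\in\mathcal{F}_2$ there exists a set $B\subset A$, $B\in\mathcal{F}_2$, such that $0<\mathbb{E}[\mathbf{1}_B\mid\mathcal{F}_1]<\mathbb{E}[\mathbf{1}_A\mid\mathcal{F}_1]$ (almost surely) on the set $\{\mathbb{E}[\mathbf{1}_A\mid\mathcal{F}_1]>0\}$. The conditional expectation with respect to $\mathcal{F}_1$ is given by the kernel $K$ if: (1) for every $\omega\in\Omega$, the mapping $K(\omega,\cdot)\colon\mathcal{F}_2\to[0,1]$ is a probability measure; (2) for each $A\in\mathcal{F}_2$, the mapping $K(\cdot,A)\colon\Omega\to[0,1]$ is $\mathcal{F}_1$-measurable; (3) for each $\xi\in L^1(\Omega,\mathcal{F}_2,\mathbb{P})$ we have $\mathbb{E}[\xi\mid\mathcal{F}_1](\omega)=\int\xi(\tau)\,K(\omega,d\tau)$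 for $\mathbb{P}$-almost every $\omega$. A probability measure $\mu$ on $\mathcal{F}_2$ is atomless if for every $A\in\mathcal{F}_2$ with $\mu(A)>0$ there is $B\in\mathcal{F}_2$, $B\subset A$, with $0<\mu(B)<\mu(A)$. ''Almost every'' refers to $\mathbb{P}$. *)

(* Defs.v *)
From HB Require Import structures.
From mathcomp Require Import all_boot all_order all_algebra.
From mathcomp Require Import all_classical all_reals all_analysis.
From mathcomp Require Import measurable_realfun.

Set Implicit Arguments.
Unset Strict Implicit.
Unset Printing Implicit Defensive.

Import Order.TTheory GRing.Theory Num.Theory.
Import numFieldNormedType.Exports.

Local Open Scope classical_set_scope.
Local Open Scope ring_scope.
Local Open Scope ereal_scope.

(* Throughout, the sigma-algebra of [T : measurableType d] is the large one;
   the small one is a set of subsets [G].  The measurable space (T, G) is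
   [g_sigma_algebraType G], whose measurable sets [<<s G>>] are exactly [G]
   when [G] is a sigma-algebra. *)
Definition sub_sigma_algebra_of {d : measure_display} (T : measurableType d)
    (G : set (set T)) : Prop :=
  sigma_algebra [set: T] G /\ G `<=` @measurable d T.

Definition countably_generated {d : measure_display}
    (T : measurableType d) : Prop :=
  exists2 C : set (set T), countable C & @measurable d T = <<s C >>.

Definition atomless {d : measure_display} {T : measurableType d}
    {R : realType} (mu : set T -> \bar R) : Prop :=
  forall A, measurable A -> 0 < mu A ->
    exists B, [/\ measurable B, B `<=` A, 0 < mu B & mu B < mu A].

(* [is_cond_exp P G X Y]: [Y] is a version of the conditional expectation of
   [X] given [G]. *)
Definition is_cond_exp {d : measure_display} {T : measurableType d}
    {R : realType} (P : probability T R) (G : set (set T)) (X Y : T -> R) :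
    Prop :=
  [/\ measurable_fun [set: g_sigma_algebraType G]
        (Y : g_sigma_algebraType G -> R),
      P.-integrable [set: T] (EFin \o Y) &
      forall A, G A -> \int[P]_(w in A) (Y w)%:E = \int[P]_(w in A) (X w)%:E].

(* A chosen version; for integrable [X] one exists ([cond_expP]), and any two
   agree almost surely ([is_cond_exp_ae_unique]). *)
Definition cond_exp {d : measure_display} {T : measurableType d}
    {R : realType} (P : probability T R) (G : set (set T)) (X : T -> R) :
    T -> R :=
  xget (fun=> 0%R) [set Y | is_cond_exp P G X Y].

Section conditional_expectation.
Context {d : measure_display} {T : measurableType d} {R : realType}
  (P : probability T R) (G : set (set T)) (subG : sub_sigma_algebra_of G).
Implicit Types X Y : T -> R.

Let GE : G.-sigma.-measurable = G.
Proof. by apply: measurable_g_measurableTypeE; case: subG. Qed.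

Let idG (x : T) : g_sigma_algebraType G := x.

Let midG : measurable_fun [set: T] idG.
Proof. by move=> _ A; rewrite setTI GE; apply: (proj2 subG). Qed.

HB.instance Definition _ := isMeasurableFun.Build _ _ _ _ idG midG.

Let mu : probability (g_sigma_algebraType G) R := distribution P idG.

Lemma cond_expP X : P.-integrable [set: T] (EFin \o X) ->
  is_cond_exp P G X (cond_exp P G X).
Proof.
move=> iX; apply: (@xgetPex _ (fun=> 0%R) [set Y | is_cond_exp P G X Y]).
pose nu0 := induced_charge iX.
pose nu : {charge set (g_sigma_algebraType G) -> \bar R} :=
  measure_function_pushforward__canonical__charge_Charge nu0 midG.
have numu : nu `<< mu.
  apply: (dominates_pushforward midG); apply/null_content_dominatesP => A mA.
  move=> PA0; apply: null_set_integral => //.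
  by apply: measurable_funTS; exact: measurable_int iX.

have ifnu := Radon_Nikodym_integrable numu.
have fnuE := Radon_Nikodym_integral numu.
have ffin x := @Radon_Nikodym_fin_num _ _ _ nu mu x numu.
move: ifnu fnuE ffin; set f := Radon_Nikodym nu mu => ifnu fnuE ffin.
have fE : EFin \o (fine \o f) = f by apply/funext => x /=; rewrite fineK.
have mf : measurable_fun setT f by exact: measurable_int ifnu.
have iPf : P.-integrable [set: T] (f \o idG).
  apply/integrableP; split; first exact: measurableT_comp.
  move/integrableP : ifnu => [_].
  rewrite (ge0_integral_pushforward midG) ?preimage_setT//.
  by apply: measurableT_comp.
exists (fine \o f); split.
- exact: measurableT_comp.
- by rewrite fE.
- move=> A GA; have mA : G.-sigma.-measurable A by rewrite GE.
  transitivity (\int[P]_(w in A) (f \o idG) w).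
    by apply: eq_integral => w _ /=; rewrite fineK.
  rewrite -(integral_pushforward midG mf _ mA) -?fnuE//.
  by apply: (integrableS measurableT _ _ iPf) => //; exact: (proj2 subG).
Qed.

Lemma is_cond_exp_ae_unique X Y1 Y2 :
  is_cond_exp P G X Y1 -> is_cond_exp P G X Y2 ->
  \forall w \ae P, Y1 w = Y2 w.
Proof.
move=> [mY1 iY1 Y1E] [mY2 iY2 Y2E].
have mpre A : G.-sigma.-measurable A -> d.-measurable (idG @^-1` A).
  by move=> mA; rewrite -[X in measurable X]setTI; exact: midG.
have intY (Y : g_sigma_algebraType G -> R) E : measurable_fun setT Y ->
    P.-integrable [set: T] (EFin \o Y) -> G.-sigma.-measurable E ->
    \int[mu]_(w in E) (EFin \o Y) w = \int[P]_(w in E) (Y w)%:E.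
  move=> mY iY mE; rewrite (integral_pushforward midG) //.
  - exact/measurable_EFinP.
  - by apply: (integrableS measurableT _ _ iY) => //; exact: mpre.
have : ae_eq mu setT (EFin \o (Y1 : g_sigma_algebraType G -> R)) (EFin \o Y2).
  apply: integral_ae_eq => //.
  - by apply: (integrable_pushforward midG) => //; exact/measurable_EFinP.
  - exact/measurable_EFinP.
  - by move=> E _ mE; rewrite !intY// Y1E ?Y2E// -GE.
move=> [N [mN N0 sN]]; exists N; split => //; first exact: mpre.
by move=> x nx; apply: sN => /= h; apply: nx; case: (h I).
Qed.

End conditional_expectation.

Definition cond_atomless {d : measure_display} {T : measurableType d}
    {R : realType} (P : probability T R) (G : set (set T)) : Prop :=
  forall A : set T, measurable A ->
    exists B : set T, [/\ measurable B, B `<=` A &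
      \forall w \ae P, (0 < cond_exp P G \1_A w)%R ->
        (0 < cond_exp P G \1_B w < cond_exp P G \1_A w)%R].

(* That [K] is a family of probability measures on T, with [K ^~ A]
   G-measurable for every measurable [A], is part of the type of [K]. *)
Definition cond_exp_given_by {d : measure_display} {T : measurableType d}
    {R : realType} (P : probability T R) (G : set (set T))
    (K : R.-pker (g_sigma_algebraType G) ~> T) : Prop :=
  forall X : T -> R, X \in Lfun P 1 ->
    \forall w \ae P, (cond_exp P G X w)%:E = \int[K w]_t (X t)%:E.

(* Main.v *)
(* For (a), conditional atomlessness is first improved to halving: of [B] and
   [A `\` B], keep on each fiber the one of smaller [K w]-measure; the choice is
   F1-measurable.  Iterating, every set of positive measure contains, on almost
   every fiber, a set of positive measure at most [2^-n].  An exhaustion argument then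
   covers the space, up to a set that is null on almost every fiber, by
   countably many such sets, and this single cover yields small subsets of all
   [A] at once, although there may be uncountably many of them.
   For (b), the sets [E] with [mu (A `&` E) = 0] or [mu (A `\` E) = 0] form a
   sigma-algebra, so if [A] can be split at all, it is split by one of the
   countably many generators; select the first generator that splits [A]
   under [K w], which is an F1-measurable choice. *)

Require Import Defs.
From HB Require Import structures.
From mathcomp Require Import all_boot all_order all_algebra.
From mathcomp Require Import all_classical all_reals all_analysis.
From mathcomp Require Import measurable_realfun.

Set Implicit Arguments.
Unset Strict Implicit.
Unset Printing Implicit Defensive.

Import Order.TTheory GRing.Theory Num.Theory.

Local Open Scope classical_set_scope.
Local Open Scope ring_scope.

(** * Exhaustion, and splitting by generators, for a single measure *)

(** The union of a sequence in [S] whose measures tend to the supremum attains it; a disjoint [E] in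
    [S] can then add no mass, as [mu] is finite. *)
Lemma measure_exhaustion (d : measure_display) (T : measurableType d)
    (R : realType) (mu : {finite_measure set T -> \bar R}) (S : set (set T)) :
  S `<=` measurable -> S set0 ->
  (forall F : nat -> set T, (forall n, S (F n)) -> S (\bigcup_n F n)) ->
  exists2 D, S D & forall E, S E -> D `&` E = set0 -> mu E = 0%E.
Proof.
move=> mS S0 SU.
have [|u Su cu] := @ereal_sup_seq R [set mu D | D in S].
  by apply/set0P; exists (mu set0), set0.
have /choice[F FP] : forall n, exists D, S D /\ mu D = u n.
  by move=> n; have [D SD <-] := Su n; exists D.
have SD : S (\bigcup_n F n) by apply: SU => n; exact: (FP n).1.
have mF n : measurable (F n) by apply: mS; exact: (FP n).1.
exists (\bigcup_n F n) => // E SE DE.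
have mD := mS _ SD.
have mE := mS _ SE.
have supD : (ereal_sup [set mu D | D in S] <= mu (\bigcup_n F n))%E.
  rewrite -(cvg_lim _ cu)//; apply: lime_le.
    by apply/cvg_ex; eexists; exact: cu.
  apply: nearW => n; rewrite -(FP n).2; apply: le_measure; rewrite ?inE//.
  exact: bigcup_sup.
have : (mu (\bigcup_n F n `|` E) <= mu (\bigcup_n F n))%E.
  apply: le_trans supD; apply: ereal_sup_ubound.
  exists (\bigcup_n F n `|` E) => //.
  by rewrite -bigcup2E; apply: SU => -[|[|n]].
rewrite measureU// => le_DE; apply/eqP; rewrite eq_le measure_ge0 andbT.
by rewrite -(@leeD2lE _ (mu _) _ _ (fin_num_measure mu _ mD)) adde0.
Qed.

(** Complementation swaps the two alternatives; a countable union either has a member carrying all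
    the mass of [A] or meets [A] in a union of null sets. *)
Lemma generated_measure_split (d : measure_display) (T : measurableType d)
    (R : realType) (mu : measure T R) (C : set (set T)) (A : set T) :
  @measurable d T = <<s C >> -> measurable A ->
  (forall c, C c -> mu (A `&` c) = 0%E \/ mu (A `\` c) = 0%E) ->
  forall E, measurable E -> mu (A `&` E) = 0%E \/ mu (A `\` E) = 0%E.
Proof.
move=> mC mA HC E mE.
suff : <<s C >> `<=`
    [set E | measurable E /\ (mu (A `&` E) = 0%E \/ mu (A `\` E) = 0%E)].
  by move=> /(_ E); rewrite -mC => /(_ mE)[].
apply: smallest_sub => [|c Cc]; last first.
  by split; [rewrite mC; exact: sub_gen_smallest|exact: HC].
split => [|B [mB]|F mF].
- by split => //; left; rewrite setI0.
- rewrite setTD => AB; split; first exact: measurableC.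
  by rewrite setDE setCK -setDE; case: AB; [right|left].
- split; first by apply: bigcupT_measurable => i; exact: (mF i).1.
  have [[i Ai]|/forallNP nA] := pselect (exists i, mu (A `\` F i) = 0%E).
    right; apply: subset_measure0 Ai => //.
    + apply: measurableD => //; apply: bigcupT_measurable => j.
      exact: (mF j).1.
    + by apply: measurableD => //; exact: (mF i).1.
    + by apply: setDS; exact: bigcup_sup.
  left; rewrite setI_bigcupr; apply/measure_negligible.
    apply: bigcupT_measurable => i; apply: measurableI => //; exact: (mF i).1.
  apply: negligible_bigcup => i; apply/negligibleP.
    by apply: measurableI => //; exact: (mF i).1.
  by case: (mF i) => _ [//|/nA].
Qed.

Lemma countably_generated_seq (d : measure_display) (T : measurableType d) :
  countably_generated T -> exists c : nat -> set T,
    (forall k, measurable (c k)) /\ @measurable d T = <<s range c >>.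
Proof.
move=> [C cC mC].
have [C0|] := pfcard_geP cC.
  (* An empty family has no enumeration; the constant sequence [set0] generates the same
     sigma-algebra. *)
  exists (fun=> set0); split => //; rewrite mC C0; apply/seteqP; split.
    exact: sub_smallest2r.
  apply: smallest_sub => [|_ [k _ <-]]; first exact: smallest_sigma_algebra.
  by have [] := @smallest_sigma_algebra _ setT (@set0 (set T)).
move=> /surjfunPex[c Cc]; exists c.
rewrite mC -Cc; split => // k.
by apply: sub_gen_smallest; rewrite Cc; exists k.
Qed.

Lemma measure_fin_num (d : measure_display) (T : measurableType d)
    (R : realType) (mu : measure T R) (A : set T) :
  (mu setT < +oo)%E -> measurable A -> mu A \is a fin_num.
Proof.
move=> fmu mA; rewrite ge0_fin_numE//; apply: le_lt_trans fmu.
by apply: le_measure; rewrite ?inE.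
Qed.

Lemma atomless_generated_split (d : measure_display) (T : measurableType d)
    (R : realType) (mu : measure T R) (c : nat -> set T) (A : set T) :
  (mu setT < +oo)%E -> @measurable d T = <<s range c >> ->
  atomless mu -> measurable A -> (0 < mu A)%E ->
  exists k, (0 < mu (A `&` c k) < mu A)%E.
Proof.
move=> fmu mc atm mA A0; have [B [mB BA B0 ltBA]] := atm _ mA A0.
have mck k : measurable (c k).
  by rewrite mc; apply: sub_gen_smallest; exists k.
apply: contrapT => /forallNP nk.
have muAE E : measurable E -> mu A = (mu (A `&` E) + mu (A `\` E))%E.
  by move=> mE; rewrite [in LHS](measureDI mu mA mE) addeC.
have [|AB|AB] := @generated_measure_split _ _ _ mu _ A mc mA _ B mB.
- move=> _ [k _ <-]; have := nk k; rewrite measure_gt0.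
  have [E _|k0 /negP] := eqVneq (mu (A `&` c k)) 0%E; first by left.
  (* A trace of [A] on [c k] that is not null carries all of [mu A]; cancelling this finite mass
     leaves zero outside [c k]. *)
  rewrite /= (muAE _ (mck k)) -leNgt => le_k; right; apply/eqP.
  rewrite eq_le measure_ge0 andbT.
  rewrite -(@leeD2lE _ (mu (A `&` c k))) ?adde0//.
  by apply: measure_fin_num => //; exact: measurableI.
- by move: B0; rewrite -AB setIC (setIidl BA) ltxx.
- move: ltBA; rewrite (muAE _ mB) AB adde0.
  by rewrite setIC (setIidl BA) ltxx.
Qed.

(** * Behaviour of the kernel on almost every fiber *)

Section kernel_conditional_expectation.
Context (d : measure_display) (T : measurableType d) (R : realType)
  (P : probability T R) (F1 : set (set T)) (hF1 : sub_sigma_algebra_of F1)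
  (K : R.-pker (g_sigma_algebraType F1) ~> T) (hK : cond_exp_given_by P K).

Let F1_measurable : F1.-sigma.-measurable = F1.
Proof. by apply: measurable_g_measurableTypeE; case: hF1. Qed.

Let kernel_fin_num w (A : set T) : measurable A -> K w A \is a fin_num.
Proof. by apply: measure_fin_num; rewrite prob_kernel ltry. Qed.

Lemma cond_exp_indic_kernel (A : set T) : measurable A ->
  \forall w \ae P, (cond_exp P F1 \1_A w)%:E = K w A.
Proof.
move=> mA; have : \1_A \in Lfun P 1.
  by apply/Lfun1_integrable; exact: integrable_indic.
move=> /hK; apply: filterS => w ->.
by rewrite integral_indic// setIT.
Qed.

(* The cast [(w : T)] keeps [w] from being typed in [g_sigma_algebraType F1],
   where the filter instance of [P] is not found. *)
Lemma is_cond_exp_indic_kernel (A : set T) (Y : T -> R) : measurable A ->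
  is_cond_exp P F1 \1_A Y -> \forall w \ae P, K (w : T) A = (Y w)%:E.
Proof.
move=> mA AY.
have AE := is_cond_exp_ae_unique hF1 AY (cond_expP hF1 (integrable_indic P mA)).
by apply: filterS2 _ AE (cond_exp_indic_kernel mA) => w -> <-.
Qed.

(** The indicator of a set in [F1] is its own conditional expectation. *)
Lemma kernel_subalgebra (G : set T) : F1 G ->
  \forall w \ae P, K (w : T) G = (\1_G w)%:E.
Proof.
move=> FG; have mG := hF1.2 _ FG; apply: is_cond_exp_indic_kernel => //.
split => //; last exact: integrable_indic.
by apply: measurable_indic; rewrite F1_measurable.
Qed.

(** The zero function is a version of the conditional expectation of the indicator of a null set. *)
Lemma kernel_null (A : set T) : measurable A -> P A = 0%E ->
  \forall w \ae P, K (w : T) A = 0%E.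
Proof.
move=> mA PA; apply: (@is_cond_exp_indic_kernel _ (cst 0)) => //; split.
- exact: measurable_cst.
- exact: integrable0.
- move=> B /hF1.2 mB; rewrite integral0 integral_indic//.
  apply/esym; apply: subset_measure0 PA => //; exact: measurableI.
Qed.

(* The exceptional set depends on [G] only, not on [B] and [E]. *)
Lemma kernel_local (G : set T) : F1 G ->
  \forall w \ae P, G w -> forall B E, measurable B -> measurable E ->
    B `&` G = E `&` G -> K (w : T) B = K w E.
Proof.
move=> FG; apply: filterS _ (kernel_subalgebra FG) => w KG Gw B E mB mE BE.
have mG := hF1.2 _ FG.
have KGC : K w (~` G) = 0%E.
  have : K w setT = (K w G + K w (~` G))%E.
    by rewrite -measureU ?setUv ?setICr//; exact: measurableC.
  rewrite prob_kernel KG indicE mem_set//= => E1.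
  apply/eqP; rewrite eq_le measure_ge0 andbT -(@leeD2lE _ 1%E)// adde0.
  by rewrite [leRHS]E1.
have KI D : measurable D -> K w D = K w (D `&` G).
  move=> mD; rewrite (measureDI (K w) mD mG).
  rewrite [X in (X + _)%E](_ : _ = 0%E) ?add0e//.
  apply: subset_measure0 KGC => //; first exact: measurableD.
  exact: measurableC.
by rewrite (KI B)// (KI E)// BE.
Qed.

(** For fixed [A] and [B], chosen versions and kernel values agree almost surely; this lets the rest
    work with [K] alone. *)
Lemma cond_atomless_kernel : cond_atomless P F1 <->
  forall A, measurable A -> exists B, [/\ measurable B, B `<=` A &
    \forall w \ae P, (0 < K (w : T) A)%E -> (0 < K w B < K w A)%E].
Proof.
split=> H A mA; have [B [mB BA HB]] := H _ mA; exists B; split => //.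
- apply: filterS3 _ (cond_exp_indic_kernel mA) (cond_exp_indic_kernel mB) HB.
  by move=> w <- <-; rewrite !lte_fin.
- apply: filterS3 _ (cond_exp_indic_kernel mA) (cond_exp_indic_kernel mB) HB.
  by move=> w <- <-; rewrite !lte_fin.
Qed.

(** * From conditional atomlessness to atomless fibers *)

Lemma cond_atomless_half (A : set T) : cond_atomless P F1 -> measurable A ->
  exists B, [/\ measurable B, B `<=` A &
    \forall w \ae P, (0 < K (w : T) A)%E ->
      (0 < K w B)%E /\ (2%:E * K w B <= K w A)%E].
Proof.
move=> /cond_atomless_kernel H mA; have [B [mB BA HB]] := H _ mA.
have mAB : measurable (A `\` B) by exact: measurableD.
pose G := [set w | (K w B <= K w (A `\` B))%E].
have FG : F1 G.
  rewrite -F1_measurable -[X in measurable X](setTI G).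
  by apply: measurable_lee => //; exact: measurable_kernel.
have FGC : F1 (~` G).
  by rewrite -F1_measurable; apply: measurableC; rewrite F1_measurable.
have mG := hF1.2 _ FG.
(* This set is [B] on [G] and the rest of [A] off [G]; by [kernel_local], [K w] sees only the piece
   on the side of [w]. *)
exists ((B `&` G) `|` ((A `\` B) `\` G)); split.
- apply: measurableU; [exact: measurableI|exact: measurableD].
- by move=> x [[/BA]|[[]]].
have mBG : measurable (B `&` G `|` (A `\` B) `\` G).
  by apply: measurableU; [exact: measurableI|exact: measurableD].
apply: filterS3 _ HB (kernel_local FG) (kernel_local FGC) => w HB HG HGC KA.
have {HB}/andP[KB0 KBA] := HB KA.
have KAE : K w A = (K w B + K w (A `\` B))%E.
  by rewrite (measureDI (K w) mA mB) (setIidr BA) addeC.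
have fB : K w B \is a fin_num by exact: kernel_fin_num.
rewrite mule_natl mule2n.
have [Gw|nGw] := pselect (G w).
  rewrite (HG Gw _ B) //; first by rewrite KAE leeD2lE.
  rewrite setIUl -setIA setIid setDE -[X in _ `|` X]setIA setICl setI0.
  by rewrite setU0.
rewrite (HGC nGw _ (A `\` B)) //; last first.
  by rewrite setIUl -setIA setICr setI0 set0U setDE -setIA setIid.
have lt_AB : (K w (A `\` B) < K w B)%E by rewrite ltNge; exact/negP.
split; last by rewrite KAE; apply: leeD => //; exact: ltW.
(* The rest of [A] has positive mass because [K w B] is strictly below [K w A]. *)
by move: KBA; rewrite KAE -[X in (X < _)%E]adde0 lteD2lE.
Qed.

Lemma cond_atomless_small (n : nat) (A : set T) :
  cond_atomless P F1 -> measurable A ->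
  exists B, [/\ measurable B, B `<=` A &
    \forall w \ae P, (0 < K (w : T) A)%E ->
      (0 < K w B)%E /\ ((2 ^+ n)%:E * K w B <= K w A)%E].
Proof.
move=> atm mA; elim: n => [|n [B [mB BA HB]]].
  by exists A; split => //; apply: filterE => w; rewrite expr0 mul1e.
have [E [mE EB HE]] := cond_atomless_half atm mB.
exists E; split => //; first exact: subset_trans EB BA.
apply: filterS2 _ HB HE => w HB HE /HB[KB0 leB]; have [KE0 leE] := HE KB0.
split => //; rewrite exprSr EFinM -muleA; apply: le_trans leB.
by apply: lee_wpmul2l; rewrite ?lee_fin ?exprn_ge0.
Qed.

Lemma cond_atomless_kernel_small (n : nat) : cond_atomless P F1 ->
  \forall w \ae P, forall A, measurable A -> (0 < K (w : T) A)%E ->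
    exists B, [/\ measurable B, B `<=` A, (0 < K w B)%E &
      ((2 ^+ n)%:E * K w B <= 1)%E].
Proof.
move=> atm.
(* The quantifier over [A] stands under the almost-everywhere one: each [D] in [S] has a single null
   set serving all its subsets [A]. *)
pose S := [set D | measurable D /\
  \forall w \ae P, forall A, measurable A -> A `<=` D -> (0 < K (w : T) A)%E ->
    exists B, [/\ measurable B, B `<=` A, (0 < K w B)%E &
      ((2 ^+ n)%:E * K w B <= 1)%E]].
have [| | |D [mD SD] maxD] := @measure_exhaustion _ _ _ P S.
- by move=> D [].
- split => //; apply: filterE => w A mA; rewrite subset0 => ->.
  by rewrite measure0 ltxx.
- move=> F SF; have mF i : measurable (F i) := (SF i).1.
  split; first exact: bigcupT_measurable.
  apply: filterS _ (ae_foralln (fun i => (SF i).2)) => w H A mA AF KA.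
  have [i KAi] : exists i, (0 < K w (A `&` F i))%E.
    apply: contrapT => /forallNP nA; move: KA; apply/negP; rewrite -leNgt.
    rewrite (_ : K w A = 0%E)//.
    rewrite -(setIidl AF) setI_bigcupr; apply/measure_negligible.
      by apply: bigcupT_measurable => i; exact: measurableI.
    apply: negligible_bigcup => i; apply/negligibleP; first exact: measurableI.
    by apply/eqP; have := nA i; rewrite measure_gt0 => /negP/negPn.
  have [||B [mB BA KB0 KB1]] := H i _ _ _ KAi; [exact: measurableI|done|].
  by exists B; split => //; exact: subset_trans BA _.
have mDC := measurableC mD.
have [B [mB BD HB]] := cond_atomless_small n atm mDC.
have SB : S B.
  split => //; apply: filterS _ HB => w HB A mA AB KA.
  (* Smallness passes from [B] to its subsets, so [A] is its own witness. *)
  exists A; split => //.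
  have leAB : (K w A <= K w B)%E by apply: le_measure; rewrite ?inE.
  have leBD : (K w B <= K w (~` D))%E by apply: le_measure; rewrite ?inE.
  have [KB le1] := HB (lt_le_trans KA (le_trans leAB leBD)).
  apply: (@le_trans _ _ (K w (~` D))); last first.
    by rewrite -(prob_kernel (s := K) w); apply: le_measure; rewrite ?inE.
  by apply: le_trans le1; apply: lee_wpmul2l; rewrite ?lee_fin ?exprn_ge0.
have PB : P B = 0%E.
  apply: maxD => //; apply/disjoints_subset.
  by rewrite -(setCK D); exact: subsetC.
apply: filterS3 _ SD HB (kernel_null mB PB) => w SD HB KB0 A mA KA.
(* By [HB], [B] would have positive mass if the complement of [D] had. *)
have KDC : K w (~` D) = 0%E.
  apply/eqP; rewrite -[_ == _]negbK -measure_gt0; apply/negP => /HB[].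
  by rewrite KB0 ltxx.
have KAD : K w A = K w (A `&` D).
  rewrite (measureDI (K w) mA mD) [X in (X + _)%E](_ : _ = 0%E) ?add0e//.
  by apply: subset_measure0 KDC => //; exact: measurableD.
have [|||B' [mB' BA KB' le1]] := SD (A `&` D); [exact: measurableI|done| |].
  by rewrite -KAD.
by exists B'; split => //; exact: subset_trans BA _.
Qed.

Lemma cond_atomless_ae_atomless : cond_atomless P F1 ->
  \forall w \ae P, atomless (K w).
Proof.
move=> atm.
(* The [n] needed depends on [w] and [A], so the null sets for all [n] are united first. *)
apply: filterS _ (ae_foralln (fun n => cond_atomless_kernel_small n atm)).
move=> w H A mA KA.
have fA : K w A \is a fin_num by exact: kernel_fin_num.
have [n ltn] : exists n, (1 < (2 ^+ n)%:E * K w A)%E.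
  move: KA; rewrite -(fineK fA) lte_fin => KA.
  have [n ltn] : exists n : nat, (fine (K w A))^-1 < n%:R.
    exists (Num.bound (fine (K w A))^-1).
    by apply: archi_boundP; rewrite invr_ge0 ltW.
  exists n; rewrite -EFinM lte_fin -ltr_pdivrMr// div1r (lt_trans ltn)//.
  by rewrite -natrX ltr_nat ltn_expl.
have [B [mB BA KB0 KB1]] := H n A mA KA.
exists B; split => //.
by rewrite -(@lte_pmul2l _ (2 ^+ n)%:E) ?lte_fin ?exprn_gt0// (le_lt_trans KB1).
Qed.

(** * From atomless fibers to conditional atomlessness *)

Lemma ae_atomless_cond_atomless : countably_generated T ->
  (\forall w \ae P, atomless (K (w : T))) -> cond_atomless P F1.
Proof.
move=> /countably_generated_seq[c [mc cE]] atm.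
apply/cond_atomless_kernel => A mA.
pose U k : set T := [set w | (0 < K w (A `&` c k) < K w A)%E].
have FU k : F1 (U k).
  rewrite -F1_measurable.
  have -> : U k = (setT `&` [set w | (0 < K w (A `&` c k))%E]) `&`
                  (setT `&` [set w | (K w (A `&` c k) < K w A)%E]).
    by rewrite !setTI; apply/seteqP; split => w /andP.
  apply: measurableI; apply: measurable_lte => //; apply: measurable_kernel;
    by [|exact: measurableI].
(* [G k] keeps the [w] for which [c k] is the first generator splitting [A]. *)
pose G := seqDU U.
have FG k : F1 (G k).
  rewrite -F1_measurable; apply: measurableD; first by rewrite F1_measurable.
  by apply: bigsetU_measurable => i _; rewrite F1_measurable.
have mG k : measurable (G k) := hF1.2 _ (FG k).
pose B := \bigcup_k ((A `&` c k) `&` G k).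
have mB : measurable B.
  apply: bigcupT_measurable => k; apply: measurableI => //.
  exact: measurableI.
exists B; split => //; first by move=> x [k _ [[]]].
have loc := ae_foralln (fun k => kernel_local (FG k)).
apply: filterS2 _ atm loc => w atm loc KA.
have [|k Uk] := atomless_generated_split _ cE atm mA KA.
  by rewrite prob_kernel ltry.
have [j _ Gj] : (\bigcup_j G j) w by rewrite -seqDU_bigcup_eq; exists k.
(* On [G j], [B] coincides with the trace of [A] on [c j]: the [G i] are disjoint, so no other index
   contributes there. *)
rewrite (loc j Gj B (A `&` c j)) //; first by case: Gj.
- exact: measurableI.
- apply/seteqP; split => x; last by move=> xj; split; [exists j|case: xj].
  move=> [[i _ [Aci Gi]] Gjx]; split => //.
  by have <- : i = j; [apply: (trivIset_seqDU U) => //; exists x|].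
Qed.

End kernel_conditional_expectation.

Theorem theorem3 (d : measure_display) (T : measurableType d) (R : realType)
    (P : probability T R) (F1 : set (set T))
    (hF1 : sub_sigma_algebra_of F1)
    (K : R.-pker (g_sigma_algebraType F1) ~> T)
    (hK : cond_exp_given_by P K) :
  (cond_atomless P F1 -> \forall w \ae P, atomless (K w))
  /\
  (countably_generated T ->
   (\forall w \ae P, atomless (K w)) -> cond_atomless P F1).
Proof.
split; first exact: cond_atomless_ae_atomless.
exact: ae_atomless_cond_atomless.
Qed.
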